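(* Extender entropy is a conjugacy invariant: if $X$ and $Y$ are nonempty two-sided shift spaces (over possibly different finite alphabets) that are conjugate, then $h_E(X) = h_E(Y)$.
   Context: A two-sided shift space over a finite alphabet $A$ is a subset $X \subset A^{\mathbb{Z}}$ which is closed (product topology) and invariant under the left shift $\sigma$, $(\sigma x)(n) = x(n+1)$. Two shift spaces $X, Y$ are conjugate if there is a continuous bijection $\varphi: X \to Y$ with $\varphi\circ\sigma = \sigma\circ\varphi$. The language $L(X)$ is the set of all finite words appearing in points of $X$, and $L_n(X)$ is the set of words of length $n$ in $L(X)$. For $w \in L(X)$, the extender set $E_X(w)$ is the set of all pairs $(s,u)$ with $s,u \in L(X)$ such that the concatenation $swu$ occurs in some point of $X$. Set $E_X(n) = \{E_X(w) : w \in L_n(X)\}$. The extender entropy of $X$ is $h_E(X) = \lim_{n\to\infty} \frac{1}{n}\log|E_X(n)|$ (this limit exists for every shift space). *)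

(* Defs.v *)
From mathcomp Require Import all_boot all_order all_algebra.
From mathcomp Require Import finmap.
From mathcomp Require Import all_classical all_reals all_analysis.

Set Implicit Arguments.
Unset Strict Implicit.
Unset Printing Implicit Defensive.

Import Order.TTheory GRing.Theory Num.Theory.
Import numFieldTopology.Exports numFieldNormedType.Exports.

Local Open Scope classical_set_scope.
Local Open Scope ring_scope.

Notation full_shift A := {ptws int -> discrete_topology A}.

Definition left_shift (A : finType) (x : full_shift A) : full_shift A :=
  fun n : int => x (n + 1).

(* "Invariant" means sigma(X) = X, i.e. invariance under the Z-action generated
   by sigma, the standard meaning for two-sided shifts. *)
Definition shift_space (A : finType) (X : set (full_shift A)) : Prop :=
  closed X /\ @left_shift A @` X = X.

(* A map X -> Y is represented by a map between the ambient full shifts of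
   which only the restriction to X matters: continuity is for the subspace
   topology of X, and the other two conditions quantify over X only. *)
Definition conjugate (A B : finType)
    (X : set (full_shift A)) (Y : set (full_shift B)) : Prop :=
  exists phi : full_shift A -> full_shift B,
    [/\ {within X, continuous phi},
        set_bij X Y phi &
        forall x, X x -> phi (left_shift x) = left_shift (phi x)].

Definition occurs_in (A : finType) (w : seq A) (x : full_shift A) : Prop :=
  exists i : int, w = mkseq (fun k : nat => x (i + k%:Z) : A) (size w).

Definition language (A : finType) (X : set (full_shift A)) : set (seq A) :=
  [set w | exists2 x, X x & occurs_in w x].

Definition language_n (A : finType) (X : set (full_shift A)) (n : nat) :
    set (seq A) :=
  [set w | language X w /\ size w = n].

Definition extender_set (A : finType) (X : set (full_shift A)) (w : seq A) :
    set (seq A * seq A) :=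
  [set su | [/\ language X su.1, language X su.2 &
                exists2 x, X x & occurs_in (su.1 ++ w ++ su.2) x]].

Definition extender_sets (A : finType) (X : set (full_shift A)) (n : nat) :
    set (set (seq A * seq A)) :=
  [set extender_set X w | w in language_n X n].

(* [extender_sets X n] is finite, being the image of a set of words of length n
   over a finite alphabet, so [fset_set] does not take its default value. *)
Definition extender_entropy (R : realType) (A : finType)
    (X : set (full_shift A)) : R :=
  limn (fun n : nat => n%:R^-1 * ln (#|` fset_set (extender_sets X n)|%:R : R)).

(* Main.v *)
(* By compactness a conjugacy and its inverse are sliding block maps, of some
   common radius r.  If x in X corresponds to y in Y, the extender set of
   y[0, m + 2r) is then determined by the extender set of x[r, r + m) together
   with the first and last 4r letters of y[0, m + 2r): to replace y1[0, m + 2r)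
   by y2[0, m + 2r) in a point of Y, replace the corresponding m letters in its
   preimage and map back; within 2r of the ends nothing changes because y1 and
   y2 agree there.  Hence |E_Y(m + 2r)| <= C |E_X(m)|, and symmetrically, so
   that log |E_X(n)| / n and log |E_Y(n)| / n have the same limits. *)
Require Import Defs.
From mathcomp Require Import all_boot all_order all_algebra.
From mathcomp Require Import finmap zify ring.
From mathcomp Require Import all_classical all_reals all_analysis.

Set Implicit Arguments.
Unset Strict Implicit.
Unset Printing Implicit Defensive.

Import Order.TTheory GRing.Theory Num.Theory.
Import numFieldTopology.Exports numFieldNormedType.Exports.

Local Open Scope classical_set_scope.
Local Open Scope ring_scope.

(** * Compactness and finite windows *)

Definition agree (A : finType) (x y : full_shift A) (a b : int) : Prop :=
  forall i : int, a <= i < b -> x i = y i.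

Lemma agreeC (A : finType) (x y : full_shift A) (a b : int) :
  agree x y a b -> agree y x a b.
Proof. by move=> xy i /xy. Qed.

Lemma near_coord (A : finType) (T : topologicalType) (K : set T)
    (f : T -> full_shift A) (p : T) (n : int) :
  {within K, continuous f} -> K p ->
  \forall x \near p, K x -> f x n = f p n.
Proof.
move=> /subspace_continuousP cf /cf cfp.
have cn := @proj_continuous _ (fun _ : int => discrete_topology A) n.
have /cfp : nbhs (f p) [set y : full_shift A | y n = f p n].
  apply: (cn (f p) [set f p n]).
  by apply: open_nbhs_nbhs; split => //; exact: discrete_open.
by rewrite /= nbhs_simpl.
Qed.

Lemma compact_full_shift (A : finType) : compact [set: full_shift A].
Proof.
have cA : forall i : int, compact [set: discrete_topology A].
  move=> i; apply: finite_compact; exact: (@finite_finset A).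
have := tychonoff cA.
by rewrite (_ : [set f | _] = setT) //; apply/seteqP; split.
Qed.

(** The compactness argument behind the Curtis-Hedlund-Lyndon theorem. With two maps it serves both
    directions: [f = id] gives a window for a conjugacy, [g = id] one for its inverse. *)
Lemma compact_window (A B : finType) (T : topologicalType) (K : set T)
    (f : T -> full_shift A) (g : T -> full_shift B) :
  compact K -> {within K, continuous f} -> {within K, continuous g} ->
  (forall p q, K p -> K q -> f p = f q -> g p 0 = g q 0) ->
  exists r : nat, forall p q, K p -> K q ->
    agree (f p) (f q) (- r%:Z) (r%:Z + 1) -> g p 0 = g q 0.
Proof.
move=> cK cf cg fg; apply: contrapT => /forallNP nor.
(* A cluster point of the sets of counterexamples would be a pair [(p, q)] with
   [f p = f q] but [g p 0 <> g q 0]. *)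
pose S (r : nat) := [set pq : T * T | [/\ K pq.1, K pq.2,
  agree (f pq.1) (f pq.2) (- r%:Z) (r%:Z + 1) & g pq.1 0 <> g pq.2 0]].
have S0 r : S r !=set0.
  have /existsNP[p /existsNP[q /not_implyP[Kp /not_implyP[Kq]]]] := nor r.
  by move=> /not_implyP[a b]; exists (p, q).
have SS m n : (m <= n)%N -> S n `<=` S m.
  move=> mn pq [K1 K2 a b]; split => // i ii; apply: a; lia.
pose F := filter_from [set: nat] S.
have FF : ProperFilter F.
  apply: filter_from_proper => //.
  apply: filter_from_filter; first by exists 0%N.
  move=> i j _ _; exists (maxn i j) => // pq Spq.
  by split; apply: SS Spq; rewrite ?leq_maxl ?leq_maxr.
have FK : F (K `*` K) by exists 0%N => // pq [].
have [[p q] [[/= Kp Kq] cl]] := compact_setX cK cK FF FK.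
have {}cl (U V : set T) r : nbhs p U -> nbhs q V ->
    exists p' q', [/\ U p', V q' & S r (p', q')].
  move=> Up Vq.
  have /cl : F (S r) by exists r.
  move=> /(_ (U `*` V)) []; first by exists (U, V).
  by move=> [p' q'] [? []]; exists p', q'.
suff fpq : f p = f q.
  have [p' [q' [U V [Kp' Kq' _]]]] :=
    cl _ _ 0%N (near_coord 0 cg Kp) (near_coord 0 cg Kq).
  by rewrite U// V//; apply; apply: fg.
apply/funext => n.
have [p' [q' [U V [Kp' Kq' a _]]]] :=
  cl _ _ `|n|%N (near_coord n cf Kp) (near_coord n cf Kq).
by rewrite -U// -V//; apply: a; lia.
Qed.

(** * Translations, and conjugacies as pairs of sliding block codes *)

Definition translate (A : finType) (k : int) (x : full_shift A) :
  full_shift A := fun n => x (n + k).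

Definition shift_invariant (A : finType) (X : set (full_shift A)) : Prop :=
  forall k x, X x -> X (translate k x).

Lemma translate0 (A : finType) (x : full_shift A) : translate 0 x = x.
Proof. by apply/funext => i; rewrite /translate addr0. Qed.

Lemma left_shift_translate (A : finType) (k : int) (x : full_shift A) :
  left_shift (translate k x) = translate (k + 1) x.
Proof.
by apply/funext => i; rewrite /translate /left_shift; congr (x _); lia.
Qed.

Lemma left_shift_inj (A : finType) : injective (@left_shift A).
Proof.
move=> x y e; apply/funext => i.
by have := congr1 (@^~ (i - 1)) e; rewrite /left_shift subrK.
Qed.

Lemma shift_space_invariant (A : finType) (X : set (full_shift A)) :
  shift_space X -> shift_invariant X.
Proof.
move=> [_ sX] k x Xx.
have sXx z : X z -> X (left_shift z) by move=> Xz; rewrite -sX; exists z.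
elim/int_rect: k => [|n IH|n IH].
- by rewrite translate0.
- rewrite (_ : n.+1%:Z = n%:Z + 1); last by lia.
  by rewrite -left_shift_translate; exact: sXx.
(* To go left, [sX] supplies a preimage in [X] under the shift, and injectivity identifies it with
   the next translate. *)
- move: IH; rewrite (_ : - n%:Z = - n.+1%:Z + 1); last by lia.
  by rewrite -left_shift_translate -{1}sX => -[z Xz /left_shift_inj <-].
Qed.

Lemma conj_translate (A B : finType) (X : set (full_shift A))
    (phi : full_shift A -> full_shift B) (k : int) (x : full_shift A) :
  shift_invariant X ->
  (forall x, X x -> phi (left_shift x) = left_shift (phi x)) -> X x ->
  phi (translate k x) = translate k (phi x).
Proof.
move=> sX phiS Xx; elim/int_rect: k => [|n IH|n IH].
- by rewrite !translate0.
- rewrite (_ : n.+1%:Z = n%:Z + 1); last by lia.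
  by rewrite -!left_shift_translate phiS ?IH //; exact: sX.
- apply: left_shift_inj; rewrite -phiS; last exact: sX.
  by rewrite !left_shift_translate (_ : - n.+1%:Z + 1 = - n%:Z); last by lia.
Qed.

(** A relation instead of a map makes the notion symmetric in [X] and [Y]. The last two clauses are
    the sliding block codes of radius [r], one in each direction. *)
Definition block_conjugacy (A B : finType) (X : set (full_shift A))
    (Y : set (full_shift B)) (r : nat)
    (G : full_shift A -> full_shift B -> Prop) : Prop :=
  [/\ forall x y, G x y -> X x /\ Y y,
      forall x, X x -> exists y, G x y,
      forall y, Y y -> exists x, G x y,
      forall x y x' y' a b, G x y -> G x' y' ->
        agree x x' (a - r%:Z) (b + r%:Z) -> agree y y' a b &
      forall x y x' y' a b, G x y -> G x' y' ->
        agree y y' (a - r%:Z) (b + r%:Z) -> agree x x' a b].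

Lemma block_conjugacyC (A B : finType) (X : set (full_shift A))
    (Y : set (full_shift B)) (r : nat)
    (G : full_shift A -> full_shift B -> Prop) :
  block_conjugacy X Y r G -> block_conjugacy Y X r (fun y x => G x y).
Proof.
move=> [h1 h2 h3 h4 h5]; split => //.
- by move=> y x /h1[].
- by move=> y x y' x' a b g g'; apply: h5.
- by move=> y x y' x' a b g g'; apply: h4.
Qed.

Lemma conjugate_block (A B : finType) (X : set (full_shift A))
    (Y : set (full_shift B)) :
  shift_space X -> conjugate X Y ->
  exists r G, block_conjugacy X Y r G.
Proof.
move=> sX [phi [cphi [phiXY phi_inj phi_surj] phiS]].
have iX := shift_space_invariant sX.
have cX : compact X.
  by apply: subclosed_compact (@compact_full_shift A) _ => //; case: sX.
have cid : {within X, continuous (id : full_shift A -> full_shift A)}.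
  by apply: continuous_subspaceT => x; exact: cvg_id.
have [|r1 w1] := compact_window cX cid cphi; first by move=> p q _ _ /= ->.
have [|r2 w2] := compact_window cX cphi cid.
  by move=> p q Xp Xq /= e; rewrite (phi_inj p q) ?inE.
exists (maxn r1 r2), (fun x y => X x /\ y = phi x); split.
- by move=> x y [Xx ->]; split=> //; apply: phiXY.
- by move=> x Xx; exists (phi x).
- by move=> y /phi_surj[x Xx <-]; exists x.
- move=> x _ x' _ a b [Xx ->] [Xx' ->] xx' i iab.
  (* Translating by [i] brings coordinate [i] to 0, where the window is known. *)
  have := w1 _ _ (iX i _ Xx) (iX i _ Xx').
  rewrite !(conj_translate _ iX phiS) // /translate !add0r; apply => j jr.
  by apply: xx'; lia.
- move=> x _ x' _ a b [Xx ->] [Xx' ->] xx' i iab.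
  have := w2 _ _ (iX i _ Xx) (iX i _ Xx').
  rewrite !(conj_translate _ iX phiS) // /translate !add0r; apply => j jr.
  by apply: xx'; lia.
Qed.

(** * Replacing words across a conjugacy *)

(* Inclusion of the extender set of [x1] on [a, a + n) in that of [x2], with
   words pinned to their coordinates; see [replaceableP]. *)
Definition replaceable (A : finType) (X : set (full_shift A))
    (x1 x2 : full_shift A) (a : int) (n : nat) : Prop :=
  forall x l h, X x -> agree x x1 a (a + n%:Z) ->
    exists x', [/\ X x', agree x' x2 a (a + n%:Z),
                   agree x' x l a & agree x' x (a + n%:Z) h].

Lemma replaceable_transfer (A B : finType) (X : set (full_shift A))
    (Y : set (full_shift B)) (r m : nat)
    (G : full_shift A -> full_shift B -> Prop)
    (x1 x2 : full_shift A) (y1 y2 : full_shift B) :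
  block_conjugacy X Y r G -> (2 * r <= m)%N -> G x1 y1 -> G x2 y2 ->
  agree y1 y2 0 (4 * r)%N%:Z ->
  agree y1 y2 (m%:Z - (2 * r)%N%:Z) (m + 2 * r)%N%:Z ->
  replaceable X x1 x2 r%:Z m -> replaceable Y y1 y2 0 (m + 2 * r)%N.
Proof.
move=> [Gdom totX totY wy wx] rm g1 g2 yl yr rep y l h Yy yy1.
have [x g] := totY y Yy; have [Xx _] := Gdom _ _ g.
have xx1 : agree x x1 r%:Z (r%:Z + m%:Z).
  by apply: wx g g1 _ => i ii; apply: yy1; lia.
have x12l : agree x1 x2 r%:Z (3 * r)%N%:Z.
  by apply: wx g1 g2 _ => i ii; apply: yl; lia.
have x12r : agree x1 x2 (m%:Z - r%:Z) (m%:Z + r%:Z).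
  by apply: wx g1 g2 _ => i ii; apply: yr; lia.
(* [l - `|l|] and [h + `|h|] are bounds that do not cut into [0, m + 2r). *)
have [x' [Xx' x'm x'l x'r]] :=
  rep x (l - `|l|%N%:Z - r%:Z) (h + `|h|%N%:Z + (m + 3 * r)%N%:Z) Xx xx1.
have [y' g'] := totX x' Xx'; have [_ Yy'] := Gdom _ _ g'.
have y'm : agree y' y2 (2 * r)%N%:Z m%:Z.
  by apply: wy g' g2 _ => i ii; apply: x'm; lia.
(* [x'] equals [x] up to [3r]: left of [r] by the choice of [x'], and on [[r, 3r)] because there
   [x' = x2 = x1 = x]. The block code loses [r]. *)
have y'l : agree y' y (l - `|l|%N%:Z) (2 * r)%N%:Z.
  apply: wy g' g _ => i ii; have [ir|ir] := ltP i r%:Z.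
    by apply: x'l; lia.
  by rewrite x'm ?xx1 ?x12l //; lia.
have y'r : agree y' y m%:Z (h + `|h|%N%:Z + (m + 2 * r)%N%:Z).
  apply: wy g' g _ => i ii; have [ir|ir] := leP (r%:Z + m%:Z) i.
    by apply: x'r; lia.
  by rewrite x'm ?xx1 ?x12r //; lia.
exists y'; split => //.
(* On the two end pieces, [[0, 2r)] and [[m, m + 2r)], the chain is [y' = y = y1 = y2]; the middle
   is [y'm]. *)
- move=> i ii; have [i1|i1] := ltP i (2 * r)%N%:Z.
    by rewrite y'l ?yy1 ?yl //; lia.
  have [i2|i2] := ltP i m%:Z; first by apply: y'm; lia.
  by rewrite y'r ?yy1 ?yr //; lia.
- by move=> i ii; apply: y'l; lia.
- by move=> i ii; apply: y'r; lia.
Qed.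

(** * Words at fixed coordinates and their extender sets *)

Definition block (A : finType) (x : full_shift A) (a : int) (n : nat) : seq A :=
  mkseq (fun k : nat => x (a + k%:Z) : A) n.

Lemma size_block (A : finType) (x : full_shift A) (a : int) (n : nat) :
  size (block x a n) = n.
Proof. by rewrite size_mkseq. Qed.

Lemma block_cat (A : finType) (x : full_shift A) (a : int) (m n : nat) :
  block x a (m + n) = block x a m ++ block x (a + m%:Z) n.
Proof.
rewrite /block /mkseq iotaD map_cat; congr (_ ++ _).
rewrite add0n -[X in iota X n]addn0 iotaDl -map_comp.
by apply: eq_map => k /=; congr (x _); lia.
Qed.

Lemma block_translate (A : finType) (x : full_shift A) (k a : int) (n : nat) :
  block (translate k x) a n = block x (a + k) n.
Proof. by apply: eq_map => i; congr (x _); lia. Qed.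

Lemma eq_block (A : finType) (x y : full_shift A) (a : int) (n : nat) :
  block x a n = block y a n <-> agree x y a (a + n%:Z).
Proof.
split=> [e i ii|xy].
  have := congr1 (fun s => nth (x i) s `|i - a|%N) e.
  rewrite !nth_mkseq; try lia.
  by rewrite (_ : a + _ = i) //; lia.
apply/eq_in_map => k; rewrite mem_iota => kn; apply: xy; lia.
Qed.

Lemma block_language (A : finType) (X : set (full_shift A)) (x : full_shift A)
    (a : int) (n : nat) :
  X x -> language X (block x a n).
Proof. by move=> Xx; exists x => //; exists a; rewrite size_block. Qed.

(** Shift invariance moves any occurrence of [s ++ w ++ u] so that [w] sits on [[a, a + n)]. *)
Lemma extender_setP (A : finType) (X : set (full_shift A)) (x1 : full_shift A)
    (a : int) (n : nat) (s u : seq A) :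
  shift_invariant X ->
  extender_set X (block x1 a n) (s, u) <->
  exists x, [/\ X x, s = block x (a - (size s)%:Z) (size s),
                agree x x1 a (a + n%:Z) & u = block x (a + n%:Z) (size u)].
Proof.
move=> sX; split=> [[/= _ _ [x Xx [i]]]|[x [Xx es /eq_block e eu]]].
  rewrite -/(block _ _ _) !size_cat size_block => e.
  exists (translate (i - (a - (size s)%:Z)) x).
  move: e; rewrite !block_cat => /eqP.
  rewrite !eqseq_cat ?size_block // => /and3P[/eqP es /eqP ew /eqP eu].
  split; first exact: sX.
  - by rewrite {1}es block_translate; congr block; lia.
  - by apply/eq_block; rewrite block_translate ew; congr block; lia.
  - by rewrite {1}eu block_translate; congr block; lia.
split=> /=.
- by rewrite es; exact: block_language.
- by rewrite eu; exact: block_language.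
exists x => //; exists (a - (size s)%:Z).
rewrite -/(block _ _ _) !size_cat size_block !block_cat -es subrK -eu.
by rewrite e.
Qed.

Lemma replaceableP (A : finType) (X : set (full_shift A))
    (x1 x2 : full_shift A) (a : int) (n : nat) :
  shift_invariant X ->
  replaceable X x1 x2 a n <->
  extender_set X (block x1 a n) `<=` extender_set X (block x2 a n).
Proof.
move=> sX; split=> [rep [s u]|sub x l h Xx xx1].
  move=> /(extender_setP _ _ _ _ _ sX)[x [Xx es xx1 eu]].
  have [x' [Xx' x'm x'l x'r]] :=
    rep x (a - (size s)%:Z) (a + n%:Z + (size u)%:Z) Xx xx1.
  apply/(extender_setP _ _ _ _ _ sX); exists x'; split=> //.
  - by rewrite {1}es; apply/esym/eq_block; rewrite subrK.
  - by rewrite {1}eu; apply/esym/eq_block.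
(* Absolute values give contexts long enough to cover [[l, a)] and [[a + n, h)], also when these are
   empty. *)
pose p := absz (a - l)%R; pose q := absz (h - (a + n%:Z))%R.
have /sub : extender_set X (block x1 a n)
    (block x (a - p%:Z) p, block x (a + n%:Z) q).
  by apply/(extender_setP _ _ _ _ _ sX); exists x; rewrite !size_block.
move=> /(extender_setP _ _ _ _ _ sX)[x']; rewrite !size_block.
move=> [Xx' /esym/eq_block x'l x'm /esym/eq_block x'r]; exists x'; split=> //.
- by move=> i ii; apply: x'l; lia.
- by move=> i ii; apply: x'r; lia.
Qed.

(** The position [a] is free, since the count below reads [X] from coordinate [r] and [Y] from
    coordinate 0. *)
Lemma extender_setsE (A : finType) (X : set (full_shift A)) (a : int)
    (n : nat) :
  shift_invariant X ->
  extender_sets X n = [set extender_set X (block x a n) | x in X].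
Proof.
move=> sX; apply/seteqP; split=> [_ [w [[x Xx [i ew]] sw] <-]|_ [x Xx <-]].
  exists (translate (i - a) x); first exact: sX.
  rewrite block_translate ew sw; congr (extender_set X (block _ _ _)); lia.
exists (block x a n) => //; split; first exact: block_language.
by rewrite size_block.
Qed.

(** * Counting extender sets *)

Lemma finite_extender_sets (A : finType) (X : set (full_shift A)) (n : nat) :
  finite_set (extender_sets X n).
Proof.
apply: (@sub_finite_set _ _ ((fun t : n.-tuple A => extender_set X t) @` setT)).
  by move=> _ [w [_ /eqP sw] <-]; exists (Tuple sw).
by apply: finite_image; exact: finite_finset.
Qed.

Lemma card_factor_le (T : Type) (U V : choiceType) (S : set T) (W : set V)
    (f : T -> U) (k : T -> V) :
  finite_set W -> (forall p, S p -> W (k p)) ->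
  (forall p q, S p -> S q -> k p = k q -> f p = f q) ->
  (#|` fset_set (f @` S)| <= #|` fset_set W|)%N.
Proof.
move=> Wfin SW fk; have [->|/set0P[p0 Sp0]] := eqVneq S set0.
  by rewrite image_set0 fset_set0 cardfs0.
(* [f] factors through [k] on [S]; off the image of [k] the value is the default [f p0], hence the
   separate case of empty [S]. *)
have [h hf] : exists h : V -> U, forall p, S p -> f p = h (k p).
  suff /choice[h hh] : forall v, exists u, forall p, S p -> k p = v -> f p = u.
    by exists h => p Sp; apply: hh.
  move=> v; have [[p [Sp <-]]|nv] := pselect (exists p, S p /\ k p = v).
    by exists (f p) => q Sq /esym kq; exact/esym/fk.
  by exists (f p0) => p Sp kp; case: nv; exists p.
have [n Wn] := (finite_setP W).1 Wfin.
apply: geq_card_fset_set; rewrite (card_fset_set Wn) -(card_le_eqr Wn).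
apply: card_le_trans (card_image_le h W); apply: subset_card_le.
by move=> _ [p Sp <-]; exists (k p); [exact: SW|rewrite hf].
Qed.

Lemma card_fset_setX_le (U V : choiceType) (P : set U) (Q : set V) :
  finite_set P -> finite_set Q ->
  (#|` fset_set (P `*` Q)| <= #|` fset_set P| * #|` fset_set Q|)%N.
Proof.
move=> Pfin Qfin; rewrite fset_setX //.
set P' := fset_set P; set Q' := fset_set Q.
rewrite (_ : (P' `*` Q')%fset =
    [fset p in [seq (x, y) | x <- P', y <- Q']]%fset).
  by rewrite card_fseq -(size_allpairs pair); exact: size_undup.
apply/fsetP => -[x y]; rewrite in_fsetM in_fset.
apply/andP/allpairsP => [[xP yQ]|[[x' y'] /= [xP yQ [-> ->]]]] //.
by exists (x, y).
Qed.

Lemma card_extender_sets_le (A B : finType) (X : set (full_shift A))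
    (Y : set (full_shift B)) (r : nat)
    (G : full_shift A -> full_shift B -> Prop) :
  shift_invariant X -> shift_invariant Y -> block_conjugacy X Y r G ->
  exists C : nat, forall m, (2 * r <= m)%N ->
    (#|` fset_set (extender_sets Y (m + 2 * r))|
      <= #|` fset_set (extender_sets X m)| * C)%N.
Proof.
move=> sX sY XYG; have [Gdom _ totY _ _] := XYG.
pose E : finType := {ffun 'I_(4 * r) -> B}.
pose ext (y : full_shift B) (a : int) : E := [ffun i : 'I__ => y (a + i%:Z)].
have ext_agree y y' a : ext y a = ext y' a -> agree y y' a (a + (4 * r)%N%:Z).
  move=> e i ii; have ir : (`|(i - a)%R|%N < 4 * r)%N by lia.
  have := congr1 (fun h : E => h (Ordinal ir)) e.
  by rewrite !ffunE /= (_ : a + _ = i) //; lia.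
(* The constant counts pairs of words of length [4r] over [B], whatever [m] is. *)
exists #|` fset_set [set: E * E]| => m rm.
pose S := [set p : full_shift A * full_shift B | G p.1 p.2].
rewrite (_ : extender_sets Y _ = (fun p : full_shift A * full_shift B =>
    extender_set Y (block p.2 0 (m + 2 * r))) @` S); last first.
  rewrite (extender_setsE 0) //; apply/seteqP; split.
    by move=> _ [y /totY[x g] <-]; exists (x, y).
  by move=> _ [[x y] /= /Gdom[_ Yy] <-]; exists y.
have finT : finite_set [set: E * E] by exact: finite_finset.
apply: leq_trans (card_fset_setX_le _ finT); last exact: finite_extender_sets.
(* The key of [(x, y)]: the extender set of [x] on [[r, r + m)], and the first and last [4r] letters
   of [y] on [[0, m + 2r)]. *)
apply: (@card_factor_le _ _ _ _ _ _ (fun p : full_shift A * full_shift B =>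
  (extender_set X (block p.1 r%:Z m),
    (ext p.2 0, ext p.2 (m%:Z - (2 * r)%N%:Z))))).
- by apply: finite_setX => //; exact: finite_extender_sets.
- move=> [x y] /= /Gdom[Xx _]; split => //=.
  by rewrite (extender_setsE r%:Z) //; exists x.
move=> [x1 y1] [x2 y2] /= g1 g2 [eX /ext_agree yl /ext_agree yr].
rewrite add0r in yl.
have {}yr : agree y1 y2 (m%:Z - (2 * r)%N%:Z) (m + 2 * r)%N%:Z.
  by move=> i ii; apply: yr; lia.
have tr := replaceable_transfer XYG rm.
apply/seteqP; split; apply/(replaceableP _ _ _ _ sY).
- by apply: tr g1 g2 yl yr _; apply/(replaceableP _ _ _ _ sX); rewrite eX.
- apply: tr g2 g1 (agreeC yl) (agreeC yr) _.
  by apply/(replaceableP _ _ _ _ sX); rewrite eX.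
Qed.

Lemma card_extender_sets_gt0 (A : finType) (X : set (full_shift A)) (n : nat) :
  X !=set0 -> (0 < #|` fset_set (extender_sets X n)|)%N.
Proof.
move=> [x Xx]; rewrite cardfs_gt0; apply/negP => /eqP.
move=> /(fset_set_set0 (finite_extender_sets X n)) e.
suff: set0 (extender_set X (block x 0 n)) by [].
rewrite -e; exists (block x 0 n) => //; split; first exact: block_language.
by rewrite size_block.
Qed.

(** * Limits of means under bounded shifts *)

Lemma cvg_ratio_shift (R : realType) (u : nat -> R) (l : R) (p q : nat) :
  (fun n => n%:R^-1 * u n) @ \oo --> l ->
  (fun n => (n + p)%:R^-1 * u (n + q)%N) @ \oo --> l.
Proof.
move=> ul.
have h0 : (fun n => (n + p)%:R^-1 : R) @ \oo --> (0 : R).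
  case: p => [|p].
    rewrite -cvg_shiftS /=.
    under eq_fun do rewrite addn0; exact: cvg_harmonic.
  have := @cvg_harmonic R; rewrite -(cvg_shiftn p) /=.
  by under eq_fun do rewrite -addnS.
have uq : (fun n => (n + q)%:R^-1 * u (n + q)%N) @ \oo --> l.
  by rewrite (cvg_shiftn q (fun n => n%:R^-1 * u n)).
(* [(n + q) / (n + p) = 1 + (q - p) / (n + p)], which tends to 1. *)
have : (fun n => (n + q)%:R^-1 * u (n + q)%N *
    (1 + (q%:R - p%:R) * (n + p)%:R^-1)) @ \oo --> l * (1 + (q%:R - p%:R) * 0).
  by apply: cvgM => //; apply: cvgD; [exact: cvg_cst|apply: cvgMl_tmp].
rewrite mulr0 addr0 mulr1; apply: cvg_trans; apply: near_eq_cvg.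
near=> n; have n0 : (0 < n)%N by near: n; exact: nbhs_infty_gt.
have nq : (n + q)%:R != 0 :> R by rewrite pnatr_eq0; lia.
have np : (n + p)%:R != 0 :> R by rewrite pnatr_eq0; lia.
by move: nq np; rewrite /= !natrD => nq np; field; rewrite nq np.
Unshelve. all: by end_near.
Qed.

(** Squeeze [b (n + 3k) - d <= a (n + 2k) <= b (n + k) + c]; starting at [n + 2k] puts both
    hypotheses in their range, and the constants vanish after division. *)
Lemma cvg_mean_quasi_shift (R : realType) (a b : nat -> R) (k : nat)
    (c d l : R) :
  (forall m, (k <= m)%N -> a (m + k)%N <= b m + c) ->
  (forall m, (k <= m)%N -> b (m + k)%N <= a m + d) ->
  (fun n => n%:R^-1 * b n) @ \oo --> l ->
  (fun n => n%:R^-1 * a n) @ \oo --> l.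
Proof.
move=> ab ba bl; rewrite -(cvg_shiftn (k + k)) /=.
have rc e p : (fun n => (n + p)%:R^-1 * e) @ \oo --> (0 : R).
  have e0 : (fun n => n%:R^-1 * e) @ \oo --> (0 : R).
    rewrite -cvg_shiftS /=.
    by have := cvgM (@cvg_harmonic R) (cvg_cst e); rewrite mul0r; apply.
  exact: (@cvg_ratio_shift R (fun=> e) 0 p 0).
have lo : (fun n => (n + (k + k))%:R^-1 * (b (n + (k + k + k))%N - d)) @ \oo
    --> l.
  rewrite -[l]subr0; under eq_fun do rewrite mulrBr.
  by apply: cvgB => //; exact: cvg_ratio_shift.
have hi : (fun n => (n + (k + k))%:R^-1 * (b (n + k)%N + c)) @ \oo --> l.
  rewrite -[l]addr0; under eq_fun do rewrite mulrDr.
  by apply: cvgD => //; exact: cvg_ratio_shift.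
apply: squeeze_cvgr lo hi; apply: nearW => n.
rewrite !ler_wpM2l ?invr_ge0 //.
- by rewrite addnA; apply: ab; lia.
- by rewrite lerBlDr !addnA; apply: ba; lia.
Qed.

(* [lim] is a choice from the set of limits, so it takes the same junk value on
   all divergent sequences. *)
Lemma limn_eq (R : realType) (u v : nat -> R) :
  (forall l : R, u @ \oo --> l <-> v @ \oo --> l) -> limn u = limn v.
Proof.
move=> uv; rewrite /lim /lim_in; congr (xget _ _); apply/seteqP.
by split=> l /uv.
Qed.

(** * Comparison of the entropies *)

Lemma ln_card_extender_sets_le (R : realType) (A B : finType)
    (X : set (full_shift A)) (Y : set (full_shift B)) (r : nat)
    (G : full_shift A -> full_shift B -> Prop) :
  shift_invariant X -> shift_invariant Y -> X !=set0 -> Y !=set0 ->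
  block_conjugacy X Y r G ->
  exists c : R, forall m, (2 * r <= m)%N ->
    ln (#|` fset_set (extender_sets Y (m + 2 * r))|%:R : R)
      <= ln #|` fset_set (extender_sets X m)|%:R + c.
Proof.
move=> sX sY X0 Y0 /(card_extender_sets_le sX sY)[C Cle].
exists (ln C%:R) => m rm.
have pX := card_extender_sets_gt0 m X0.
have pY := card_extender_sets_gt0 (m + 2 * r) Y0.
have pXC := leq_trans pY (Cle m rm).
(* Positivity of all three factors lets [ln] turn the product into a sum. *)
have pC : (0 < C)%N by move: pXC; rewrite muln_gt0 => /andP[].
rewrite -lnM ?posrE ?ltr0n // -natrM ler_ln ?posrE ?ltr0n // ler_nat.
exact: Cle.
Qed.

Theorem theorem3p3 (R : realType) (A B : finType)
    (X : set (full_shift A)) (Y : set (full_shift B)) :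
  shift_space X -> X !=set0 ->
  shift_space Y -> Y !=set0 ->
  conjugate X Y ->
  extender_entropy R X = extender_entropy R Y.
Proof.
move=> sX X0 sY Y0 /(conjugate_block sX)[r [G XYG]].
have [iX iY] := (shift_space_invariant sX, shift_space_invariant sY).
have [c YX] := ln_card_extender_sets_le R iX iY X0 Y0 XYG.
have [d XY] := ln_card_extender_sets_le R iY iX Y0 X0 (block_conjugacyC XYG).
(* The two bounds, one from each direction of the conjugacy, give both sequences the same limits. *)
apply: limn_eq => l; split.
- exact: cvg_mean_quasi_shift YX XY.
- exact: cvg_mean_quasi_shift XY YX.
Qed.
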